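(* Let $G$ be a profinite group with $\mathrm{VZ}(G)=\{1\}$, and let $(L,\eta)$ be a topologically simple envelope of $G$. Then $L$ is rigid if and only if $\eta_*(L)=\mathrm{ICom}(G)$.
   Context: For a topological group $L$, the virtual center is $\mathrm{VZ}(L)=\{g\in L: \text{the centralizer of } g \text{ in } L \text{ is open in } L\}$. Commensurator of a profinite group $G$: a virtual automorphism of $G$ is a topological isomorphism between two open subgroups of $G$; two are equivalent if they coincide on some open subgroup of $G$; the equivalence classes $[\phi]$ form, under composition (after restricting to suitable open subgroups), a group $\mathrm{Comm}(G)$. The homomorphism $\iota_G:G\to\mathrm{Comm}(G)$ sends $g$ to the class of conjugation $x\mapsto gxg^{-1}$; $\iota(G)$ is its image. The inner commensurator $\mathrm{ICom}(G)$ is the normal subgroup of $\mathrm{Comm}(G)$ generated by $\iota(G)$. An envelope of a profinite group $G$ is a pair $(L,\eta)$ where $L$ is a topological group and $\eta:G\to L$ is an injective homomorphism such that $\eta(G)$ is open in $L$ and $\eta$ is a homeomorphism onto $\eta(G)$ (so $L$ is totally disconnected locally compact); it is called topologically simple if the group $L$ is topologically simple, i.e. $L$ is non-trivial and has no closed normal subgroups other than $\{1\}$ and $L$. The canonical homomorphism $\eta_*:L\to\mathrm{Comm}(G)$ is defined, after identifying $G$ with $\eta(G)$, by letting $\eta_*(l)$ be the class of the virtual automorphism $x\mapsto lxl^{-1}$ from $G\cap l^{-1}Gl$ to $lGl^{-1}\cap G$. A totally disconnected locally compact group $L$ is called rigid if for every topological isomorphism $\phi:U\to V$ between open compact subgroups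 $U$ and $V$ of $L$ there exists a unique $\phi_\circ\in\mathrm{Aut}(L)$ with $\phi_\circ|_U=\phi$, where $\mathrm{Aut}(L)$ is the group of continuous automorphisms of $L$.
   Formalization: The formal theorem also assumes that G is nontrivial; for G = {1} the claim fails, e.g. for L = Z/3 discrete, where η_*(L) = ICom(G) = {1} but L is not rigid since the identity of {1} extends to two automorphisms. *)

(* Defs.v *)
From HB Require Import structures.
From mathcomp Require Import all_boot generic_quotient.
From mathcomp Require Import all_classical topology.

Set Implicit Arguments.
Unset Strict Implicit.
Unset Printing Implicit Defensive.

Local Open Scope quotient_scope.
Local Open Scope classical_set_scope.
Local Open Scope group_scope.

HB.mixin Record isTopologicalGroup G & Group G & Topological G := {
  mulg_continuous : continuous (fun p : G * G => p.1 * p.2) ;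
  invg_continuous : continuous (fun x : G => x^-1)
}.

#[short(type="topologicalGroupType")]
HB.structure Definition TopologicalGroup :=
  {G of Group G & Topological G & isTopologicalGroup G}.

Definition profinite (G : topologicalGroupType) : Prop :=
  [/\ compact [set: G], hausdorff_space G & totally_disconnected [set: G]].

Section Subgroups.
Context {G : groupType}.
Implicit Type H : set G.

Definition subgroup H : Prop :=
  [/\ H 1, forall x y, H x -> H y -> H (x * y) & forall x, H x -> H x^-1].

Definition normal_subgroup H : Prop :=
  subgroup H /\ forall g x, H x -> H (g * x * g^-1).

End Subgroups.

Section TopologicalGroups.
Context {G : topologicalGroupType}.

Definition open_subgroup (H : set G) : Prop := open H /\ subgroup H.

Definition compact_open_subgroup (H : set G) : Prop :=
  open_subgroup H /\ compact H.

Definition centralizer (g : G) : set G := [set h | commute g h].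

End TopologicalGroups.

Definition virtual_center (G : topologicalGroupType) : set G :=
  [set g | open (centralizer g)].
Arguments virtual_center : clear implicits.

Definition topologically_simple (L : topologicalGroupType) : Prop :=
  [set: L] <> [set 1] /\
  forall N : set L, closed N -> normal_subgroup N -> N = [set 1] \/ N = setT.

Section TopologicalIsomorphisms.
Context {G H : topologicalGroupType}.

(* Only the restrictions of f to A and of g to B matter: the values of the
   total functions f and g elsewhere are irrelevant. *)
Record mutual_top_iso (A : set G) (B : set H) (f : G -> H) (g : H -> G) :
    Prop := MutualTopIso {
  top_iso_fun : forall x, A x -> B (f x) ;
  top_iso_inv : forall y, B y -> A (g y) ;
  top_isoK : forall x, A x -> g (f x) = x ;
  top_isoVK : forall y, B y -> f (g y) = y ;
  top_isoM : forall x y, A x -> A y -> f (x * y) = f x * f y ;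
  top_iso_continuous : {within A, continuous f} ;
  top_iso_inv_continuous : {within B, continuous g}
}.

Definition top_iso (A : set G) (B : set H) (f : G -> H) : Prop :=
  exists g, mutual_top_iso A B f g.

End TopologicalIsomorphisms.

(* For Aut(L) to be a group, automorphisms are required to be homeomorphisms. *)
Definition top_automorphism (L : topologicalGroupType) (f : L -> L) : Prop :=
  top_iso setT setT f.

Definition rigid (L : topologicalGroupType) : Prop :=
  forall (U V : set L) (phi : L -> L),
    compact_open_subgroup U -> compact_open_subgroup V -> top_iso U V phi ->
  exists! phi0 : L -> L,
    top_automorphism phi0 /\ forall x, U x -> phi0 x = phi x.

Section Helpers.
Context {G H : topologicalGroupType}.

Lemma subgroupI (A B : set G) : subgroup A -> subgroup B -> subgroup (A `&` B).
Proof.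
move=> [A1 AM AV] [B1 BM BV]; split=> //.
- by move=> x y [? ?] [? ?]; split; [exact: AM | exact: BM].
- by move=> x [? ?]; split; [exact: AV | exact: BV].
Qed.

Lemma open_subgroupT : open_subgroup [set: G].
Proof. by split; [exact: openT|]. Qed.

Lemma open_subgroupI (A B : set G) :
  open_subgroup A -> open_subgroup B -> open_subgroup (A `&` B).
Proof.
move=> [oA sA] [oB sB]; split; [exact: openI | exact: subgroupI].
Qed.

Lemma conj_continuous (a : G) : continuous (fun x => a * x * a^-1).
Proof.
have mulr (b : G) : continuous (fun x => x * b).
  move=> x; apply: (@continuous2_cvg _ _ _ _ _ _ id (fun=> b) (fun x y => x * y)).
  - exact: (mulg_continuous (x, b)).
  - exact: cvg_id.
  - exact: cvg_cst.
have mull (b : G) : continuous (fun x => b * x).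
  move=> x; apply: (@continuous2_cvg _ _ _ _ _ _ (fun=> b) id (fun x y => x * y)).
  - exact: (mulg_continuous (b, x)).
  - exact: cvg_cst.
  - exact: cvg_id.
move=> x; apply: (@continuous_comp _ _ _ (fun x => a * x) (fun x => x * a^-1)).
- exact: mull.
- exact: mulr.
Qed.

Lemma mutual_top_iso_sym (A : set G) (B : set H) f g :
  subgroup A -> subgroup B -> mutual_top_iso A B f g -> mutual_top_iso B A g f.
Proof.
move=> [_ AM _] [_ BM _] [fA gB fK gK fM cf cg]; split=> // x y Bx By.
by rewrite -{1}(gK x)// -{1}(gK y)// -fM ?fK//; [apply: AM| |]; exact: gB.
Qed.

Lemma mutual_top_iso1 (A : set G) (B : set H) f g :
  subgroup A -> mutual_top_iso A B f g -> f 1 = 1.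
Proof.
move=> [A1 _ _] [_ _ _ _ fM _ _]; apply: (@mulgI _ (f 1)).
by rewrite -fM// !mulg1.
Qed.

Lemma mutual_top_isoV (A : set G) (B : set H) f g x :
  subgroup A -> mutual_top_iso A B f g -> A x -> f x^-1 = (f x)^-1.
Proof.
move=> sA fg Ax; have [A1 _ AV] := sA; apply: (@mulgI _ (f x)).
by rewrite -(top_isoM fg) ?mulgV ?(mutual_top_iso1 sA fg)//; exact: AV.
Qed.

Lemma open_subgroup_preimage (A : set G) (B C : set H) f g :
  open_subgroup A -> mutual_top_iso A B f g -> open_subgroup C ->
  open_subgroup [set x | A x /\ C (f x)].
Proof.
move=> [oA sA] fg [oC [C1 CM CV]]; have [A1 AM AV] := sA; split.
  have := top_iso_continuous fg; rewrite continuous_open_subspace//.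
  by move=> /(continuous_inP _ oA)/(_ _ oC).
split=> /=.
- by rewrite (mutual_top_iso1 sA fg).
- move=> x y [Ax Cx] [Ay Cy]; split; first exact: AM.
  by rewrite (top_isoM fg)//; exact: CM.
- move=> x [Ax Cx]; split; first exact: AV.
  by rewrite (mutual_top_isoV sA fg)//; exact: CV.
Qed.

End Helpers.

Section WithinComp.
Context {X Y Z : topologicalType}.

Lemma within_open_comp (A : set X) (B : set Y) (C : set X)
    (f : X -> Y) (g : Y -> Z) :
  open A -> open B -> open C -> C `<=` A -> (forall x, C x -> B (f x)) ->
  {within A, continuous f} -> {within B, continuous g} ->
  {within C, continuous (g \o f)}.
Proof.
move=> oA oB oC CA CB.
rewrite !continuous_open_subspace// => cf cg x /set_mem Cx.
apply: continuous_comp; first by apply: cf; apply/mem_set/CA.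
by apply: cg; apply/mem_set/CB.
Qed.

End WithinComp.

Section Commensurator.
Context {G : topologicalGroupType}.

Record virtual_aut := VirtualAut {
  va_dom : set G ;
  va_cod : set G ;
  va_fun :> G -> G ;
  va_inv : G -> G ;
  va_dom_open : open_subgroup va_dom ;
  va_cod_open : open_subgroup va_cod ;
  va_iso : mutual_top_iso va_dom va_cod va_fun va_inv
}.

HB.instance Definition _ := gen_eqMixin virtual_aut.
HB.instance Definition _ := gen_choiceMixin virtual_aut.

Implicit Types f g h : virtual_aut.

Definition va_equiv f g : Prop :=
  exists2 W : set G, open_subgroup W &
    [/\ W `<=` va_dom f, W `<=` va_dom g & forall x, W x -> f x = g x].

Lemma va_equiv_refl f : va_equiv f f.
Proof. by exists (va_dom f); [exact: va_dom_open | split]. Qed.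

Lemma va_equiv_sym f g : va_equiv f g -> va_equiv g f.
Proof. by move=> [W oW [Wf Wg fg]]; exists W => //; split=> // x /fg. Qed.

Lemma va_equiv_trans f g h : va_equiv f g -> va_equiv g h -> va_equiv f h.
Proof.
move=> [W oW [Wf Wg fg]] [W' oW' [W'g W'h gh]].
exists (W `&` W'); first exact: open_subgroupI.
split=> [x [/Wf]//|x [_ /W'h]//|x [Wx W'x]]; by rewrite fg// gh.
Qed.

Definition va_equivb : rel virtual_aut := fun f g => `[< va_equiv f g >].

Lemma va_equivb_refl : reflexive va_equivb.
Proof. by move=> f; apply/asboolP/va_equiv_refl. Qed.

Lemma va_equivb_sym : symmetric va_equivb.
Proof. by move=> f g; apply/asboolP/asboolP => /va_equiv_sym. Qed.

Lemma va_equivb_trans : transitive va_equivb.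
Proof.
by move=> g f h /asboolP fg /asboolP gh; apply/asboolP/(va_equiv_trans fg).
Qed.

Canonical va_equivb_equiv :=
  EquivRel va_equivb va_equivb_refl va_equivb_sym va_equivb_trans.

Section Id.

Let iso1 : mutual_top_iso [set: G] [set: G] id id.
Proof. by split=> //; apply: continuous_subspaceT; by move=> x; exact: cvg_id. Qed.

Definition va_one := VirtualAut open_subgroupT open_subgroupT iso1.

End Id.

Section Inv.
Variable f : virtual_aut.

Let isoV : mutual_top_iso (va_cod f) (va_dom f) (va_inv f) f.
Proof.
apply: mutual_top_iso_sym (va_iso f).
- exact: (va_dom_open f).2.
- exact: (va_cod_open f).2.
Qed.

Definition va_opp := VirtualAut (va_cod_open f) (va_dom_open f) isoV.

End Inv.

Section Comp.
Variables f g : virtual_aut.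

Let A : set G := [set x | va_dom g x /\ va_dom f (g x)].
Let B : set G := [set y | va_cod f y /\ va_cod g (va_inv f y)].

Let openA : open_subgroup A.
Proof.
exact: open_subgroup_preimage (va_dom_open g) (va_iso g) (va_dom_open f).
Qed.

Let openB : open_subgroup B.
Proof.
exact: (open_subgroup_preimage (va_cod_open f) (va_iso (va_opp f))
                               (va_cod_open g)).
Qed.

Let isoM : mutual_top_iso A B (f \o g) (va_inv g \o va_inv f).
Proof.
have [[oDf _] [oCf _]] := (va_dom_open f, va_cod_open f).
have [[oDg _] [oCg _]] := (va_dom_open g, va_cod_open g).
have [fA fB fK fVK fM fc fVc] := va_iso f.
have [gA gB gK gVK gM gc gVc] := va_iso g.
split=> /=.
- by move=> x [gx fx]; split; [exact: fA | rewrite fK//; exact: gA].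
- by move=> x [fx gx]; split; [exact: gB | rewrite gVK//; exact: fB].
- by move=> x [gx fx]; rewrite fK// gK.
- by move=> x [fx gx]; rewrite gVK// fVK.
- by move=> x y [gx fx] [gy fy]; rewrite gM// fM.
- apply: (within_open_comp oDg oDf openA.1) => // x.
  + by case.
  + by case.
- apply: (within_open_comp oCf oCg openB.1) => // x.
  + by case.
  + by case.
Qed.

Definition va_comp := VirtualAut openA openB isoM.

End Comp.

Definition Comm := {eq_quot va_equivb}.

HB.instance Definition _ := Choice.on Comm.

Definition Comm_class f : Comm := \pi f.

Lemma Comm_classP f g : Comm_class f = Comm_class g <-> va_equiv f g.
Proof.
split; first by move/eqquotP/asboolP.
by move=> fg; apply/eqquotP/asboolP.
Qed.

Lemma Comm_class_repr (c : Comm) : Comm_class (repr c) = c.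
Proof. exact: reprK. Qed.

Lemma va_comp_equiv f f' g g' :
  va_equiv f f' -> va_equiv g g' -> va_equiv (va_comp f g) (va_comp f' g').
Proof.
move=> [W oW [Wf Wf' ff']] [W' oW' [Wg Wg' gg']].
exists (W' `&` [set x | va_dom g x /\ W (g x)]).
  apply: open_subgroupI => //.
  exact: open_subgroup_preimage (va_dom_open g) (va_iso g) oW.
split=> /= x [W'x [gx Wgx]].
- by split=> //; exact: Wf.
- by split; [exact: Wg' | rewrite -gg'//; exact: Wf'].
- by rewrite -gg'// ff'.
Qed.

Lemma va_opp_equiv f g : va_equiv f g -> va_equiv (va_opp f) (va_opp g).
Proof.
move=> [W oW [Wf Wg fg]].
exists ([set y | va_cod f y /\ W (va_inv f y)] `&`
        [set y | va_cod g y /\ W (va_inv g y)]).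
  apply: open_subgroupI.
  - exact: open_subgroup_preimage (va_cod_open f) (va_iso (va_opp f)) oW.
  - exact: open_subgroup_preimage (va_cod_open g) (va_iso (va_opp g)) oW.
split=> /= y [[fy Wfy] [gy Wgy]] //.
have := top_isoVK (va_iso f) fy; rewrite fg// => /(congr1 (va_inv g)).
by rewrite (top_isoK (va_iso g))//; exact: Wg.
Qed.

Definition Comm_one : Comm := Comm_class va_one.
Definition Comm_mul (c d : Comm) : Comm :=
  Comm_class (va_comp (repr c) (repr d)).
Definition Comm_inv (c : Comm) : Comm :=
  Comm_class (va_opp (repr c)).

Lemma Comm_mulE f g :
  Comm_mul (Comm_class f) (Comm_class g) = Comm_class (va_comp f g).
Proof.
by apply/Comm_classP/va_comp_equiv; apply/Comm_classP; exact: Comm_class_repr.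
Qed.

Lemma Comm_invE f : Comm_inv (Comm_class f) = Comm_class (va_opp f).
Proof. by apply/Comm_classP/va_opp_equiv/Comm_classP; exact: Comm_class_repr. Qed.

Lemma Comm_mulA : associative Comm_mul.
Proof.
move=> a b c; rewrite -(Comm_class_repr a) -(Comm_class_repr b).
rewrite -(Comm_class_repr c) !Comm_mulE; apply/Comm_classP.
set f := repr a; set g := repr b; set h := repr c.
exists (va_dom (va_comp f (va_comp g h))); first exact: va_dom_open.
by split=> //= x [[? ?] ?].
Qed.

Lemma Comm_mul1g : left_id Comm_one Comm_mul.
Proof.
move=> a; rewrite -(Comm_class_repr a) !Comm_mulE; apply/Comm_classP.
by exists (va_dom (repr a)); [exact: va_dom_open | split].
Qed.

Lemma Comm_mulg1 : right_id Comm_one Comm_mul.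
Proof.
move=> a; rewrite -(Comm_class_repr a) !Comm_mulE; apply/Comm_classP.
by exists (va_dom (repr a)); [exact: va_dom_open | split].
Qed.

Lemma Comm_mulVg : left_inverse Comm_one Comm_inv Comm_mul.
Proof.
move=> a; rewrite -(Comm_class_repr a) Comm_invE Comm_mulE; apply/Comm_classP.
exists (va_dom (repr a)); first exact: va_dom_open.
split=> //= x ax; last by rewrite (top_isoK (va_iso _)).
by split=> //; apply: (top_iso_fun (va_iso _)).
Qed.

Lemma Comm_mulgV : right_inverse Comm_one Comm_inv Comm_mul.
Proof.
move=> a; rewrite -(Comm_class_repr a) Comm_invE Comm_mulE; apply/Comm_classP.
exists (va_cod (repr a)); first exact: va_cod_open.
split=> //= x ax; last by rewrite (top_isoVK (va_iso _)).
by split=> //; apply: (top_iso_inv (va_iso _)).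
Qed.

HB.instance Definition _ := isGroup.Build Comm
  Comm_mulA Comm_mul1g Comm_mulg1 Comm_mulVg Comm_mulgV.

End Commensurator.

Arguments virtual_aut : clear implicits.
Arguments Comm : clear implicits.

Lemma Comm_classM (G : topologicalGroupType) (f g : virtual_aut G) :
  Comm_class f * Comm_class g = Comm_class (va_comp f g).
Proof. exact: Comm_mulE. Qed.

Section InnerCommensurator.
Context {G : topologicalGroupType}.

Section Conj.
Variable g : G.

Let conj_iso : mutual_top_iso [set: G] [set: G]
  (fun x => g * x * g^-1) (fun x => g^-1 * x * g).
Proof.
split=> //.
- by move=> x _; rewrite !mulgA mulVg mul1g mulgVK.
- by move=> x _; rewrite !mulgA mulgV mul1g mulgK.
- by move=> x y _ _; rewrite !mulgA mulgVK.
- by apply: continuous_subspaceT; exact: conj_continuous.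
- apply: continuous_subspaceT; rewrite -{2}(invgK g).
  exact: conj_continuous.
Qed.

Definition va_conj : virtual_aut G :=
  VirtualAut open_subgroupT open_subgroupT conj_iso.

End Conj.

Definition iota (g : G) : Comm G := Comm_class (va_conj g).

Lemma iotaM : {morph iota : g h / g * h}.
Proof.
move=> g h; rewrite Comm_classM; apply/Comm_classP.
exists setT; first exact: open_subgroupT.
by split=> [x _|x _|x _] //=; rewrite invgM !mulgA.
Qed.

End InnerCommensurator.

Definition ICom (G : topologicalGroupType) : set (Comm G) :=
  smallest normal_subgroup (range (@iota G)).
Arguments ICom : clear implicits.

Section Envelope.
Context {G L : topologicalGroupType}.

(* [top_iso setT (range eta) eta] says that eta is an injective homomorphism
   and a homeomorphism onto its image. *)
Definition is_envelope (eta : G -> L) : Prop :=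
  open (range eta) /\ top_iso setT (range eta) eta.

Variables (eta : G -> L) (etaP : is_envelope eta).

Definition eta_inv : L -> G := sval (cid etaP.2).

Lemma eta_isoP : mutual_top_iso setT (range eta) eta eta_inv.
Proof. exact: svalP (cid etaP.2). Qed.

Lemma eta_continuous : continuous eta.
Proof. by apply/continuous_subspace_setT; exact: top_iso_continuous eta_isoP. Qed.

Lemma open_subgroup_range : open_subgroup (range eta).
Proof.
split; first exact: etaP.1.
have sT : subgroup [set: G] by [].
split=> /=.
- by exists 1 => //; rewrite (mutual_top_iso1 sT eta_isoP).
- by move=> _ _ [x _ <-] [y _ <-]; exists (x * y); rewrite ?(top_isoM eta_isoP).
- by move=> _ [x _ <-]; exists x^-1; rewrite ?(mutual_top_isoV sT eta_isoP).
Qed.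

(* The subgroups G `&` l^-1 G l and l G l^-1 `&` G of the source, and the map
   x |-> l x l^-1 between them, after identifying G with its image. *)
Definition eta_dom (l : L) : set G :=
  [set x | range eta (l * eta x * l^-1)].
Definition eta_conj (l : L) (x : G) : G :=
  eta_inv (l * eta x * l^-1).

Lemma eta_conjE l x : eta_dom l x -> eta (eta_conj l x) = l * eta x * l^-1.
Proof. by move=> lx; rewrite /eta_conj (top_isoVK eta_isoP). Qed.

Lemma open_eta_dom l : open_subgroup (eta_dom l).
Proof.
have [oR [R1 RM RV]] := open_subgroup_range.
have [_ _ etaK _ etaM etac _] := eta_isoP.
have sT : subgroup [set: G] by [].
split.
  have cc : continuous (fun x => l * eta x * l^-1).
    move=> x; apply: (@continuous_comp _ _ _ eta (fun y => l * y * l^-1)).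
      exact: eta_continuous.
    exact: conj_continuous.
  by move/continuousP: cc => /(_ _ oR).
split.
- by rewrite /eta_dom /= (mutual_top_iso1 sT eta_isoP) mulg1 mulgV.
- move=> x y lx ly; rewrite /eta_dom /= etaM//.
  have -> : l * (eta x * eta y) * l^-1 = (l * eta x * l^-1) * (l * eta y * l^-1).
    by rewrite !mulgA mulgVK.
  exact: RM.
- move=> x lx; rewrite /eta_dom /= (mutual_top_isoV sT eta_isoP)//.
  have -> : l * (eta x)^-1 * l^-1 = (l * eta x * l^-1)^-1.
    by rewrite !invgM invgK mulgA.
  exact: RV.
Qed.

Lemma eta_conj_continuous l : {within eta_dom l, continuous (eta_conj l)}.
Proof.
have [_ _ _ _ _ etac etaVc] := eta_isoP.
apply: (@within_open_comp _ _ _ setT (range eta) _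
  (fun x => l * eta x * l^-1)) => //.
- exact: openT.
- exact: etaP.1.
- exact: (open_eta_dom l).1.
- apply: continuous_subspaceT => x.
  apply: (@continuous_comp _ _ _ eta (fun y => l * y * l^-1)).
    exact: eta_continuous.
  exact: conj_continuous.
Qed.

Lemma eta_conjK l x : eta_dom l x -> eta_conj l^-1 (eta_conj l x) = x.
Proof.
move=> lx; rewrite {1}/eta_conj eta_conjE// invgK.
by rewrite !mulgA mulVg mul1g mulgVK (top_isoK eta_isoP).
Qed.

Lemma eta_dom_conj l x : eta_dom l x -> eta_dom l^-1 (eta_conj l x).
Proof.
move=> lx; rewrite /eta_dom /= eta_conjE// invgK.
by rewrite !mulgA mulVg mul1g mulgVK; exists x.
Qed.

Lemma eta_conj_iso l :
  mutual_top_iso (eta_dom l) (eta_dom l^-1) (eta_conj l) (eta_conj l^-1).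
Proof.
split.
- exact: eta_dom_conj.
- by move=> x /eta_dom_conj; rewrite invgK.
- exact: eta_conjK.
- by move=> x /eta_conjK; rewrite invgK.
- move=> x y lx ly.
  have [_ [_ RM _]] := open_eta_dom l.
  have [_ _ etaK _ etaM _ _] := eta_isoP.
  rewrite -[LHS]etaK// -[RHS]etaK// eta_conjE; last exact: RM.
  by rewrite !etaM// !eta_conjE// !mulgA mulgVK.
- exact: eta_conj_continuous.
- exact: eta_conj_continuous.
Qed.

Definition va_eta (l : L) : virtual_aut G :=
  VirtualAut (open_eta_dom l) (open_eta_dom l^-1) (eta_conj_iso l).

Definition eta_star (l : L) : Comm G := Comm_class (va_eta l).

Lemma eta_starM : {morph eta_star : l m / l * m}.
Proof.
move=> l m; rewrite Comm_classM; apply/Comm_classP.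
exists (va_dom (va_comp (va_eta l) (va_eta m)) `&` eta_dom (l * m)).
  by apply: open_subgroupI; [exact: va_dom_open | exact: open_eta_dom].
split=> [x []//|x []//|x [[mx lx] lmx]] /=.
by rewrite {2}/eta_conj eta_conjE// /eta_conj invgM !mulgA.
Qed.

Lemma eta_star_eta (g : G) : eta_star (eta g) = iota g.
Proof.
have [_ _ etaK _ etaM _ _] := eta_isoP.
have sT : subgroup [set: G] by [].
have E x : eta (g * x * g^-1) = eta g * eta x * (eta g)^-1.
  by rewrite !etaM// (mutual_top_isoV sT eta_isoP).
apply/Comm_classP; exists (eta_dom (eta g)); first exact: open_eta_dom.
by split=> // x _ /=; rewrite /eta_conj -E etaK.
Qed.

End Envelope.

(* Main.v *)
(** Since VZ(G) = 1, the virtual center of L meets the open subgroup eta(G)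
    trivially; it is therefore discrete, hence closed, hence trivial because L
    is topologically simple and G is not trivial.  So eta_* is injective, and
    an automorphism of L is determined by its restriction to any open subgroup.

    If L is rigid, a virtual automorphism of G extends to some a in Aut(L), and
    conjugation by its class sends eta_*(l) to eta_*(a(l)); hence eta_*(L) is
    normal and contains ICom(G).  The preimage of ICom(G) in L is an open,
    hence closed, nontrivial normal subgroup, so it is L.

    Conversely, if eta_*(L) is normal in Comm(G), conjugation by the class of
    phi : U -> V induces through eta_* an automorphism of L, which extends phi
    and is continuous because it is so on the open subgroup U. *)
Require Import Defs.
From HB Require Import structures.
From mathcomp Require Import all_boot.
From mathcomp Require Import all_classical topology.

Set Implicit Arguments.
Unset Strict Implicit.
Unset Printing Implicit Defensive.

Local Open Scope classical_set_scope.
Local Open Scope group_scope.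

(** * Open subgroups and the virtual center *)

Section OpenSubgroups.
Context {G : topologicalGroupType}.
Implicit Types H U W : set G.

Lemma mull_continuous (a : G) : continuous (fun x => a * x).
Proof.
move=> x; apply: (@continuous2_cvg _ _ _ _ _ _ (fun=> a) id (fun x y => x * y)).
- exact: (mulg_continuous (a, x)).
- exact: cvg_cst.
- exact: cvg_id.
Qed.

Lemma open_lcoset (a : G) U : open U -> open [set x | U (a^-1 * x)].
Proof. by move=> oU; have /continuousP := @mull_continuous a^-1; apply. Qed.

(** [H] is a union of left cosets of [W]. *)
Lemma subgroup_open H W : subgroup H -> open_subgroup W -> W `<=` H -> open H.
Proof.
move=> [H1 HM HV] [oW [W1 _ _]] WH; rewrite openE => h Hh.
apply: (@filterS _ _ _ [set x | W (h^-1 * x)]).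
  by move=> x /= /WH Hx; rewrite -(mulVKg h x); exact: HM.
by apply: open_nbhs_nbhs; split; [exact: open_lcoset | rewrite /= mulVg].
Qed.

Lemma open_subgroup_closed H : open_subgroup H -> closed H.
Proof.
move=> [oH [H1 HM HV]]; rewrite closure_id; apply/seteqP; split.
  exact: subset_closure.
move=> x cx.
have /cx[y [Hy /= Hxy]] : nbhs x [set y | H (x^-1 * y)].
  apply: open_nbhs_nbhs; split; first exact: open_lcoset.
  by rewrite /= mulVg.
have -> : x = y * (x^-1 * y)^-1 by rewrite invgM invgK mulgA mulgV mul1g.
by apply: HM => //; exact: HV.
Qed.

(** A limit point [x] outside [H] would have two distinct points [y], [z] of [H] in [x * U]; then
    [y^-1 * z] is a nontrivial element of [H] and [U]. *)
Lemma discrete_subgroup_closed H U : open_subgroup U -> closed [set (1 : G)] ->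
  subgroup H -> H `&` U `<=` [set 1] -> closed H.
Proof.
move=> [oU [U1 UM UV]] c1 [H1 HM HV] HU.
rewrite closure_id; apply/seteqP; split; first exact: subset_closure.
move=> x cx.
have nU : nbhs x [set y | U (x^-1 * y)].
  apply: open_nbhs_nbhs; split; first exact: open_lcoset.
  by rewrite /= mulVg.
have [y [Hy /= Uxy]] := cx _ nU.
apply: contrapT => Hx.
have oy : open [set z : G | y^-1 * z <> 1].
  by apply: (@open_lcoset y (~` [set 1])); exact: closed_openC.
have ny : nbhs x [set z : G | y^-1 * z <> 1].
  apply: open_nbhs_nbhs; split=> //= yx; apply: Hx.
  by rewrite -(mulVKg y x) yx mulg1.
have [z [Hz [/= Uxz]]] := cx _ (filterI nU ny); apply.
apply: HU; split; first by apply: HM => //; exact: HV.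
have -> : y^-1 * z = (x^-1 * y)^-1 * (x^-1 * z).
  by rewrite invgM invgK !mulgA mulgK.
by apply: UM => //; exact: UV.
Qed.

Lemma open_subgroup_conj (l : G) U :
  open_subgroup U -> open_subgroup [set x | U (l * x * l^-1)].
Proof.
move=> [oU [U1 UM UV]]; split.
  by have /continuousP := @conj_continuous G l; exact.
split=> /=.
- by rewrite mulg1 mulgV.
- by move=> x y /UM xU /xU; rewrite !mulgA mulgVK.
- by move=> x /UV; rewrite !invgM invgK mulgA.
Qed.

Lemma virtual_center_open (g : G) W :
  open_subgroup W -> (forall w, W w -> commute g w) -> virtual_center G g.
Proof.
move=> oW gW; apply: (@subgroup_open _ W) => //; split.
- exact: commute1.
- by move=> x y; exact: commuteM.
- by move=> x; exact: commuteV.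
Qed.

Lemma centralizer_open_subgroup (g : G) :
  virtual_center G g -> open_subgroup (centralizer g).
Proof.
split=> //; split; first exact: commute1.
- by move=> x y; exact: commuteM.
- by move=> x; exact: commuteV.
Qed.

Lemma virtual_center_normal : normal_subgroup (virtual_center G).
Proof.
split; first split.
- apply: (virtual_center_open open_subgroupT) => w _; exact/commute_sym/commute1.
- move=> x y /centralizer_open_subgroup ox /centralizer_open_subgroup oy.
  apply: (virtual_center_open (open_subgroupI ox oy)) => w [xw yw].
  by apply/commute_sym/commuteM; exact/commute_sym.
- move=> x /centralizer_open_subgroup ox.
  by apply: (virtual_center_open ox) => w xw; apply/commute_sym/commuteV/commute_sym.
- move=> g x /centralizer_open_subgroup ox.
  (* The centralizer of [g * x * g^-1] is the conjugate by [g] of that of [x], that is, its preimage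
     under conjugation by [g^-1]. *)
  apply: (virtual_center_open (open_subgroup_conj g^-1 ox)) => w.
  rewrite /= invgK /centralizer /commute /= => /(congr1 (fun z => g * z * g^-1)).
  by rewrite !mulgA mulgV mul1g !mulgK.
Qed.

(* Two automorphisms agreeing on an open subgroup U satisfy
   a(l) a(u) a(l)^-1 = b(l) a(u) b(l)^-1 for u in U with l u l^-1 in U. *)
Lemma top_automorphism_unique (a b : G -> G) U :
  virtual_center G = [set 1] -> open_subgroup U ->
  top_automorphism a -> top_automorphism b ->
  (forall x, U x -> a x = b x) -> a = b.
Proof.
move=> VZ1 oU [a' aa] [b' bb] ab; apply/funext => l.
have sT : subgroup [set: G] by [].
have aM x y : a (x * y) = a x * a y by exact: top_isoM aa _ _ _ _.
have bM x y : b (x * y) = b x * b y by exact: top_isoM bb _ _ _ _.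
have aV x : a x^-1 = (a x)^-1 by exact: mutual_top_isoV sT aa _.
have bV x : b x^-1 = (b x)^-1 by exact: mutual_top_isoV sT bb _.
(* This is the image under [a] of the intersection of [U] and [l^-1 U l], written as a preimage
   under [a']. *)
have oW := open_subgroup_preimage open_subgroupT (mutual_top_iso_sym sT sT aa)
  (open_subgroupI oU (open_subgroup_conj l oU)).
suff : virtual_center G ((b l)^-1 * a l).
  by rewrite VZ1 => /(congr1 (fun z => b l * z)); rewrite mulVKg mulg1.
apply: (virtual_center_open oW) => y [_ [Uy Uly]].
have := ab _ Uly; rewrite !(aM, bM, aV, bV) -(ab _ Uy).
rewrite (top_isoVK aa)// => /(congr1 (fun z => (b l)^-1 * z * a l)).
by rewrite /commute !mulgA mulVg mul1g mulgVK.
Qed.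

End OpenSubgroups.

(** * Continuity and composition of local isomorphisms *)

(** Translations carry continuity at 1 to every point. *)
Lemma morph_continuous (G H : topologicalGroupType) (f : G -> H) (U : set G) :
  {morph f : x y / x * y} -> open_subgroup U -> {within U, continuous f} ->
  continuous f.
Proof.
move=> fM [oU [U1 UM UV]]; rewrite continuous_open_subspace// => fc a.
have -> : f = (fun y => f a * y) \o f \o (fun x => a^-1 * x).
  by apply/funext => x /=; rewrite -fM mulVKg.
apply: (@continuous_comp _ _ _ (fun x => a^-1 * x)); first exact: mull_continuous.
apply: (@continuous_comp _ _ _ f); last exact: mull_continuous.
by rewrite mulVg; apply: fc; exact/mem_set.
Qed.

(** Serves to carry partial isomorphisms between [G] and [L] along [eta]; since [B] and [B'] may
    differ, the composite is restricted to where it is defined. *)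
Lemma mutual_top_iso_comp (X Y Z : topologicalGroupType)
    (A : set X) (B B' : set Y) (C : set Z) f f' g g' :
  open_subgroup A -> open_subgroup B -> open_subgroup B' -> open_subgroup C ->
  mutual_top_iso A B f f' -> mutual_top_iso B' C g g' ->
  mutual_top_iso [set x | A x /\ B' (f x)] [set z | C z /\ B (g' z)]
    (g \o f) (f' \o g').
Proof.
move=> oA oB oB' oC ff gg.
have oD := open_subgroup_preimage oA ff oB'.
have oE := open_subgroup_preimage oC (mutual_top_iso_sym oB'.2 oC.2 gg) oB.
case: ff gg => [fA fB fK fVK fM fc fVc] [gA gB gK gVK gM gc gVc].
split=> /=.
- by move=> x [Ax Bx]; split; [exact: gA | rewrite gK//; exact: fA].
- by move=> z [Cz Bz]; split; [exact: fB | rewrite fVK//; exact: gB].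
- by move=> x [Ax Bx]; rewrite gK// fK.
- by move=> z [Cz Bz]; rewrite fVK// gVK.
- by move=> x y [Ax Bx] [Ay By]; rewrite fM// gM.
- by apply: (within_open_comp oA.1 oB'.1 oD.1) => // x [].
- by apply: (within_open_comp oC.1 oB.1 oE.1) => // x [].
Qed.

Lemma ICom_normal (G : topologicalGroupType) : normal_subgroup (ICom G).
Proof.
split; first split.
- by move=> N [[[N1 _ _] _] _].
- move=> x y Ix Iy N nN; have [[[_ NM _] _] _] := nN.
  by apply: NM; [exact: Ix | exact: Iy].
- move=> x Ix N nN; have [[[_ _ NV] _] _] := nN.
  by apply: NV; exact: Ix.
- move=> g x Ix N nN; have [[_ NJ] _] := nN.
  by apply: NJ; exact: Ix.
Qed.

(** * The homomorphism [eta_star] of an envelope *)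

Section Envelope.
Context {G L : topologicalGroupType} (eta : G -> L) (etaP : is_envelope eta).

Let sT : subgroup [set: G]. Proof. by []. Qed.

Let eta_invP : mutual_top_iso (range eta) setT (eta_inv etaP) eta.
Proof.
exact: mutual_top_iso_sym sT (open_subgroup_range etaP).2 (eta_isoP etaP).
Qed.

Lemma etaM (x y : G) : eta (x * y) = eta x * eta y.
Proof. exact: top_isoM (eta_isoP etaP) _ _ _ _. Qed.

Lemma eta_invK (x : G) : eta_inv etaP (eta x) = x.
Proof. exact: top_isoK (eta_isoP etaP) _ _. Qed.

Lemma eta_inj (x y : G) : eta x = eta y -> x = y.
Proof. by move=> /(congr1 (eta_inv etaP)); rewrite !eta_invK. Qed.

Lemma eta_1 : eta 1 = 1.
Proof. exact: mutual_top_iso1 sT (eta_isoP etaP). Qed.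

Lemma open_subgroup_image (W : set G) :
  open_subgroup W -> open_subgroup (eta @` W).
Proof.
move=> oW.
have := open_subgroup_preimage (open_subgroup_range etaP) eta_invP oW.
congr open_subgroup; apply/seteqP; split=> y /=.
  by move=> [[x _ <-]]; rewrite eta_invK; exists x.
by move=> [x Wx <-]; rewrite eta_invK; split=> //; exists x.
Qed.

Lemma eta_star1 : eta_star etaP 1 = 1.
Proof. by apply: (@mulgI _ (eta_star etaP 1)); rewrite -eta_starM !mulg1. Qed.

Lemma eta_starV l : eta_star etaP l^-1 = (eta_star etaP l)^-1.
Proof. by apply: (@mulgI _ (eta_star etaP l)); rewrite -eta_starM !mulgV eta_star1. Qed.

(* If f corresponds, on the open subgroup W, to a homomorphism a on L, the
   hypothesis holds with m = a l. *)
Lemma eta_star_conj (f : virtual_aut G) (l m : L) (W : set G) :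
  open_subgroup W -> W `<=` va_dom f ->
  (forall x, W x -> eta_dom eta l x -> W (eta_conj etaP l x) ->
     eta (f (eta_conj etaP l x)) = m * eta (f x) * m^-1) ->
  Comm_class f * eta_star etaP l * (Comm_class f)^-1 = eta_star etaP m.
Proof.
move=> oW Wf fE; apply: (@mulIg _ (Comm_class f)); rewrite mulgVK !Comm_classM.
apply/Comm_classP.
exists (W `&` [set x | va_dom (va_eta etaP l) x /\ W (va_eta etaP l x)]).
  apply: open_subgroupI => //.
  exact: open_subgroup_preimage (va_dom_open _) (va_iso _) oW.
split=> /= x [Wx [lx Wlx]].
- by split=> //; exact: Wf.
- by split; [exact: Wf | rewrite /eta_dom /= -fE//; exists (f (eta_conj etaP l x))].
- by rewrite {2}/eta_conj -fE// eta_invK.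
Qed.

(** * Topologically simple envelopes *)

Section SimpleEnvelope.
Hypotheses (G_profinite : profinite G) (G_neq1 : [set: G] <> [set 1]).
Hypotheses (VZ_G : virtual_center G = [set 1]) (L_simple : topologically_simple L).

(** An envelope is not assumed Hausdorff, so this is derived from [G]: the closure of 1 stays in the
    closed subgroup [range eta], where [G] separates points. *)
Lemma envelope_closed1 : closed [set (1 : L)].
Proof.
have [_ hG _] := G_profinite.
have oR := open_subgroup_range etaP.
rewrite closure_id; apply/seteqP; split; first exact: subset_closure.
move=> y cy.
have : range eta y.
  have /closure_id -> := open_subgroup_closed oR.
  by apply: (@closure_subset _ [set 1]) cy => _ ->; case: oR.2.
move=> [x _ xy]; subst y.
have c1 : closed [set (1 : G)].
  exact: (accessible_closed_set1 (hausdorff_accessible hG)).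
apply: contrapT => x1.
(* This set is the image under [eta] of the complement of 1, an open set that misses 1. *)
have ox : open (range eta `&` eta_inv etaP @^-1` (~` [set 1])).
  have := top_iso_continuous eta_invP.
  rewrite continuous_open_subspace; last exact: oR.1.
  by move/(continuous_inP _ oR.1); apply; exact: closed_openC.
have /cy[z [/= z1 [_ ez]]] :
    nbhs (eta x) (range eta `&` eta_inv etaP @^-1` (~` [set 1])).
  apply: open_nbhs_nbhs; split; first exact: ox.
  split; first by exists x.
  by rewrite /= eta_invK => xx; apply: x1; rewrite xx /= eta_1.
by apply: ez; rewrite z1 /= -eta_1 eta_invK.
Qed.

Lemma exists_eta_neq1 : exists2 x : G, x <> 1 & eta x <> 1.
Proof.
have [x x1] : exists x : G, x <> 1.
  apply: contrapT => /forallNP all1; apply: G_neq1; apply/seteqP; split=> // x _.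
  exact: contrapT (all1 x).
by exists x => //; rewrite -eta_1 => /eta_inj.
Qed.

Lemma virtual_center_range (x : G) : virtual_center L (eta x) -> x = 1.
Proof.
move=> /centralizer_open_subgroup ox.
suff : virtual_center G x by rewrite VZ_G.
have oW := open_subgroup_preimage open_subgroupT (eta_isoP etaP) ox.
apply: (virtual_center_open oW) => w [_ xw].
by apply: eta_inj; rewrite !etaM.
Qed.

Lemma virtual_center_envelope : virtual_center L = [set 1].
Proof.
have nVZ := @virtual_center_normal L.
have cVZ : closed (virtual_center L).
  apply: discrete_subgroup_closed (open_subgroup_range etaP) envelope_closed1 nVZ.1 _.
  by move=> _ [/[swap] [[x _ <-]] /virtual_center_range ->]; exact: eta_1.
have [//|VZT] := L_simple.2 _ cVZ nVZ.
have [x x1 _] := exists_eta_neq1.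
by case: x1; apply: virtual_center_range; rewrite VZT.
Qed.

(** If [l] and [m] induce the same conjugation on the image of [W], then [m^-1 * l] centralizes that
    open subgroup. *)
Lemma eta_star_inj (l m : L) : eta_star etaP l = eta_star etaP m -> l = m.
Proof.
move=> /Comm_classP[W oW [Wl Wm lm]].
suff : virtual_center L (m^-1 * l).
  rewrite virtual_center_envelope => /(congr1 (fun z => m * z)).
  by rewrite mulVKg mulg1.
apply: (virtual_center_open (open_subgroup_image oW)) => _ [x Wx <-].
have := congr1 eta (lm _ Wx); rewrite /= !eta_conjE; [|exact: Wm|exact: Wl].
move=> /(congr1 (fun z => m^-1 * z * l)).
by rewrite /commute !mulgA mulVg mul1g mulgVK.
Qed.

Lemma ICom_sub_range : rigid L -> ICom G `<=` range (eta_star etaP).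
Proof.
move=> Lrigid; apply: smallest_sub; last first.
  by move=> _ [g _ <-]; exists (eta g); rewrite ?eta_star_eta.
split; first split.
- by exists 1; rewrite ?eta_star1.
- by move=> _ _ [l _ <-] [m _ <-]; exists (l * m); rewrite ?eta_starM.
- by move=> _ [l _ <-]; exists l^-1; rewrite ?eta_starV.
move=> c _ [l _ <-]; rewrite -(Comm_class_repr c); set f := repr c.
have [oD oC] := (va_dom_open f, va_cod_open f).
(* Open subgroups of the compact group [G] are closed, hence compact, so rigidity applies to their
   images. *)
have coL (W : set G) : open_subgroup W -> compact_open_subgroup (eta @` W).
  move=> oW; split; first exact: open_subgroup_image.
  apply: continuous_compact.
    by apply: continuous_subspaceT; exact: eta_continuous.
  have [cG _ _] := G_profinite.
  by apply: subclosed_compact cG _ => //; exact: open_subgroup_closed.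
have fiso : top_iso (eta @` va_dom f) (eta @` va_cod f) (eta \o f \o eta_inv etaP).
  have oR := open_subgroup_range etaP.
  have oT := @open_subgroupT G.
  have i1 := mutual_top_iso_comp oR oT oD oC eta_invP (va_iso f).
  have i1D := open_subgroup_preimage oR eta_invP oD.
  have i1C := open_subgroup_preimage oC (va_iso (va_opp f)) oT.
  have i2 := mutual_top_iso_comp i1D i1C oT oR i1 (eta_isoP etaP).
  exists (eta \o va_inv f \o eta_inv etaP).
  (* The domains produced by composition carry redundant conditions; they equal the images of
     [va_dom f] and [va_cod f]. *)
  move: i2; congr mutual_top_iso; apply/seteqP; split=> y /=.
  - by move=> [[[x _ <-]]]; rewrite eta_invK; exists x.
  - by move=> [x Dx <-]; rewrite eta_invK; split=> //; split=> //; exists x.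
  - by move=> [[x _ <-]]; rewrite eta_invK => -[? _]; exists x.
  - by move=> [x Dx <-]; rewrite eta_invK; split=> //; exists x.
have [a [[[a' aa] aE] _]] := Lrigid _ _ _ (coL _ oD) (coL _ oC) fiso.
exists (a l) => //; rewrite (@eta_star_conj f l (a l) (va_dom f)) // => x fx lx flx.
have afE y : va_dom f y -> eta (f y) = a (eta y).
  by move=> fy; rewrite aE /= ?eta_invK//; exists y.
rewrite !afE// eta_conjE// !(top_isoM aa)//.
by rewrite (@mutual_top_isoV _ _ _ _ _ _ _ _ aa).
Qed.

Lemma range_sub_ICom : range (eta_star etaP) `<=` ICom G.
Proof.
have [[I1 IM IV] IJ] := @ICom_normal G.
pose N := [set l | ICom G (eta_star etaP l)].
have nN : normal_subgroup N.
  split; first split; rewrite /N /=.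
  - by rewrite eta_star1.
  - by move=> l m Nl Nm; rewrite eta_starM; exact: IM.
  - by move=> l Nl; rewrite eta_starV; exact: IV.
  - by move=> g l Nl; rewrite !eta_starM eta_starV; exact: IJ.
have RN : range eta `<=` N.
  move=> _ [g _ <-]; rewrite /N /= eta_star_eta.
  by apply: sub_gen_smallest; exists g.
have oN : open_subgroup N.
  split; last exact: nN.1.
  exact: (subgroup_open nN.1 (open_subgroup_range etaP) RN).
have [N1|NT] := L_simple.2 _ (open_subgroup_closed oN) nN.
  have [x _ ex] := exists_eta_neq1.
  by case: ex; have := RN _ (imageT eta x); rewrite N1.
by move=> _ [l _ <-]; have : N l by rewrite NT.
Qed.

Lemma range_normal_rigid : normal_subgroup (range (eta_star etaP)) -> rigid L.
Proof.
move=> [_ nR] U V phi [oU _] [oV _] [psi pp].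
have oR := open_subgroup_range etaP.
have oT := @open_subgroupT G.
have i1 := mutual_top_iso_comp oT oR oU oV (eta_isoP etaP) pp.
have o1D := open_subgroup_preimage oT (eta_isoP etaP) oU.
have o1C := open_subgroup_preimage oV (mutual_top_iso_sym oU.2 oV.2 pp) oR.
have i2 := mutual_top_iso_comp o1D o1C oR oT i1 eta_invP.
have o2D := open_subgroup_preimage o1D i1 oR.
have o2C := open_subgroup_preimage oT (eta_isoP etaP) o1C.
(* [phi] read in [G] through [eta], on the points of [eta^-1(U)] that [phi] sends back into
   [range eta]. *)
pose f := VirtualAut o2D o2C i2.
have fE x : va_dom f x -> eta (f x) = phi (eta x).
  by move=> [_ Rx] /=; rewrite (top_isoVK (eta_isoP etaP)).
pose c := Comm_class f.
have conjE d l : exists m, eta_star etaP m = d * eta_star etaP l * d^-1.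
  by have [|m _ mE] := nR d (eta_star etaP l); [exists l | exists m].
(* Defined for every class [d], so that [a c^-1] is available as the inverse of [a c]. *)
pose a d l := sval (cid (conjE d l)).
have aE d l : eta_star etaP (a d l) = d * eta_star etaP l * d^-1.
  exact: svalP (cid (conjE d l)).
have aM d : {morph a d : x y / x * y}.
  move=> x y; apply: eta_star_inj; rewrite aE !eta_starM !aE.
  by rewrite !mulgA mulgVK.
have aK d : cancel (a d) (a d^-1).
  by move=> x; apply: eta_star_inj; rewrite !aE invgK !mulgA mulVg mul1g mulgVK.
have aVK d : cancel (a d^-1) (a d) by move=> x; rewrite -{1}(invgK d) aK.
(* On small elements, [phi] turns conjugation by [u] into conjugation by [phi u], so [eta_star_conj]
   applies with [m = phi u]. *)
have aU u : U u -> a c u = phi u.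
  move=> Uu; apply: eta_star_inj; rewrite aE.
  apply: eta_star_conj (va_dom_open f) _ _ => // x fx ux fux.
  have Ux : U (eta x) by case: fx => -[].
  have [U1 UM UV] := oU.2.
  have UVu := UV _ Uu; have Uux := UM _ _ Uu Ux.
  rewrite !fE// eta_conjE// !(top_isoM pp)//.
  by rewrite (mutual_top_isoV oU.2 pp).
have aV v : V v -> a c^-1 v = psi v.
  move=> Vv; rewrite -{1}(top_isoVK pp Vv) -aU ?aK//.
  exact: top_iso_inv pp _ _.
have a_cont : continuous (a c).
  apply: (morph_continuous (aM c) oU); apply: subspace_eq_continuous (top_iso_continuous pp).
  by move=> x /set_mem Ux; exact/esym/aU.
have aV_cont : continuous (a c^-1).
  apply: (morph_continuous (aM c^-1) oV); apply: subspace_eq_continuous (top_iso_inv_continuous pp).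
  by move=> x /set_mem Vx; exact/esym/aV.
have a_aut : top_automorphism (a c).
  exists (a c^-1); split=> // [x _|x _|x y _ _||]; first exact: aK.
  - exact: aVK.
  - exact: aM.
  - exact: continuous_subspaceT.
  - exact: continuous_subspaceT.
exists (a c); split=> // b [b_aut bU].
apply: (top_automorphism_unique virtual_center_envelope oU) => // x Ux.
by rewrite aU// bU.
Qed.

End SimpleEnvelope.
End Envelope.

(* The hypothesis that G is nontrivial excludes discrete L: if G = {1} and L is
   a discrete simple group with a nontrivial automorphism, then
   eta_star(L) = ICom(G) = {1}, but L is not rigid because every automorphism
   of L extends the identity of {1}. *)
Theorem corollary3p9 (G L : topologicalGroupType) (eta : G -> L)
    (etaP : is_envelope eta) :
  profinite G ->
  [set: G] <> [set 1] ->
  virtual_center G = [set 1] ->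
  topologically_simple L ->
  rigid L <-> range (eta_star etaP) = ICom G.
Proof.
move=> pG G1 VZ1 sL; split=> [Lrigid|E].
  apply/seteqP; split; first exact: range_sub_ICom.
  exact: ICom_sub_range.
by apply: (range_normal_rigid pG G1 VZ1 sL (etaP := etaP)); rewrite E; exact: ICom_normal.
Qed.
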